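(* If $G$ and $H$ are graphs, then $$\operatorname{sg}(G \,\square\, H) \leq \min\{ \operatorname{sg}(H)\, n(G) - \operatorname{sg}(G) + 1,\ \operatorname{sg}(G)\, n(H) - \operatorname{sg}(H) + 1 \}.$$
   Context: All graphs are simple and connected; $n(G)$ denotes the number of vertices of $G$. Strong geodetic number: given $S\subseteq V(G)$, for each (unordered) pair of distinct vertices $x,y\in S$ select one fixed shortest $x,y$-path $\widetilde g(x,y)$. If for some such selection every vertex of $G$ lies on at least one of the selected paths, then $S$ is called a strong geodetic set of $G$. For a graph with just one vertex, that vertex is considered its unique strong geodetic set. The strong geodetic number $\operatorname{sg}(G)$ is the minimum cardinality of a strong geodetic set of $G$. The Cartesian product $G\,\square\,H$ has vertex set $V(G)\times V(H)$, with $(g,h)$ adjacent to $(g',h')$ iff either $g=g'$ and $hh'\in E(H)$, or $h=h'$ and $gg'\in E(G)$.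
   Formalization: Both G and H are assumed to have at least two vertices; without this the claim fails, e.g. for G = K_1 and H = K_2, where sg(G □ H) = 2 but sg(G) n(H) − sg(H) + 1 = 1. *)

(* Defs.v *)
From mathcomp Require Import all_boot boolp.

Set Implicit Arguments.
Unset Strict Implicit.
Unset Printing Implicit Defensive.

(* A graph on the vertex set [T] is given by its adjacency relation. *)
Definition connected_graph (T : finType) (e : rel T) : Prop :=
  [/\ symmetric e, irreflexive e & forall x y : T, connect e x y].

Definition cartesian_product (T U : finType) (e : rel T) (f : rel U) :
    rel (T * U) :=
  fun a b => ((a.1 == b.1) && f a.2 b.2) || ((a.2 == b.2) && e a.1 b.1).

(* As in [path], the starting vertex [x] is kept apart: the vertices of the
   path are [x :: p] and its length is [size p].  A shortest walk never repeats
   a vertex, so it is a path. *)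
Definition shortest_path (T : finType) (e : rel T) (x y : T) (p : seq T) : Prop :=
  [/\ path e x p, last x p = y &
      forall q : seq T, path e x q -> last x q = y -> size p <= size q].

(* [g x y] is the path selected for the unordered pair {x, y}, read from [x]
   to [y]; the condition on [rev] says that [g y x] is the same path read
   backwards, so that only one path is selected per unordered pair. *)
Definition path_selection (T : finType) (e : rel T) (S : {set T})
    (g : T -> T -> seq T) : Prop :=
  forall x y : T, x \in S -> y \in S -> x != y ->
    shortest_path e x y (g x y) /\ y :: g y x = rev (x :: g x y).

(* A one-vertex graph has no pair of distinct vertices; by convention its vertex
   set is its strong geodetic set. *)
Definition strong_geodetic (T : finType) (e : rel T) (S : {set T}) : Prop :=
  (#|T| = 1 /\ S = [set: T]) \/
  exists2 g : T -> T -> seq T, path_selection e S g &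
    forall v : T, exists x y : T,
      [/\ x \in S, y \in S, x != y & v \in x :: g x y].

(* [ [set: T] ] is only the witness required by [arg min]: it is strong geodetic
   in every nonempty connected graph, see [strong_geodetic_setT] and [sgP]. *)
Definition sg (T : finType) (e : rel T) : nat :=
  #|[arg min_(S < [set: T] | `[< strong_geodetic e S >]) #|S| ]|.

Lemma shortest_path_exists (T : finType) (e : rel T) (x y : T) :
  connect e x y -> exists p, shortest_path e x y p.
Proof.
move=> /connectP [p0 ep0 yE].
pose P n := `[< exists p, [/\ path e x p, last x p = y & size p = n] >].
have exP : exists n, P n by exists (size p0); apply/asboolP; exists p0.
have [n /asboolP[p [ep lp <-]] min_n] := ex_minnP exP.
by exists p; split=> // q eq lq; apply: min_n; apply/asboolP; exists q.
Qed.

Lemma shortest_path_rev (T : finType) (e : rel T) (x y : T) (p : seq T) :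
  symmetric e -> shortest_path e x y p ->
  shortest_path e y x (rev (belast x p)).
Proof.
move=> sym_e; have rev_walk (a b : T) q : path e a q -> last a q = b ->
    path e b (rev (belast a q)) /\ last b (rev (belast a q)) = a.
  move=> eq <-; split; last by case: q {eq} => //= c q; rewrite rev_cons last_rcons.
  by rewrite rev_path (eq_path (e' := e)) // => u v; rewrite sym_e.
move=> [ep lp min_p]; have [rp lrp] := rev_walk _ _ _ ep lp.
split=> // q eq lq; have [rq lrq] := rev_walk _ _ _ eq lq.
by have := min_p _ rq lrq; rewrite !size_rev !size_belast.
Qed.

Lemma strong_geodetic_setT (T : finType) (e : rel T) :
  connected_graph e -> 0 < #|T| -> strong_geodetic e [set: T].
Proof.
move=> [sym_e _ con_e]; rewrite leq_eqVlt => /orP[/eqP T1|T_gt1]; first by left.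
have [h hP] : exists h : T -> T -> seq T, forall x y, shortest_path e x y (h x y).
  have /choice[h hP] (xy : T * T) : exists p, shortest_path e xy.1 xy.2 p.
    exact/shortest_path_exists/con_e.
  by exists (fun x y => h (x, y)) => x y; apply: (hP (x, y)).
pose g x y := if enum_rank x < enum_rank y then h x y else rev (belast y (h y x)).
right; exists g => [x y _ _ neq_xy|v].
  have revE a b : rev (a :: h a b) = b :: rev (belast a (h a b)).
    by rewrite lastI rev_rcons; have [_ ->] := hP a b.
  rewrite /g; case: ltngtP => [lt_xy|lt_yx|/ord_inj/enum_rank_inj eq_xy].
  - by split; [exact: hP | rewrite revE].
  - by split; [exact: shortest_path_rev | rewrite -revE revK].
  - by rewrite eq_xy eqxx in neq_xy.
have /card_gt0P[w] : 0 < #|predC1 v| by rewrite cardC1 -subn1 subn_gt0.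
rewrite inE => /= neq_wv; exists v, w; rewrite !inE eqxx eq_sym.
by split.
Qed.

Lemma sgP (T : finType) (e : rel T) : connected_graph e -> 0 < #|T| ->
  (exists2 S : {set T}, strong_geodetic e S & #|S| = sg e) /\
  (forall S : {set T}, strong_geodetic e S -> sg e <= #|S|).
Proof.
move=> con_e T_gt0; rewrite /sg; case: arg_minnP => [|S /asboolP gS minS].
  exact/asboolP/strong_geodetic_setT.
by split=> [|S' /asboolP]; [exists S | exact: minS].
Qed.

Lemma sg_le_card (T : finType) (e : rel T) : sg e <= #|T|.
Proof. exact: max_card. Qed.

Lemma sg_gt0 (T : finType) (e : rel T) :
  connected_graph e -> 0 < #|T| -> 0 < sg e.
Proof.
move=> con_e T_gt0; have [[S gS <-] _] := sgP con_e T_gt0.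
have [x _] := card_gt0P T_gt0; case: gS => [[_ ->]|[g _ /(_ x)[y [z [Sy _ _ _]]]]].
  by rewrite cardsT.
by apply/card_gt0P; exists y.
Qed.

(* The truncated subtraction of [nat] is harmless in [sg H * n(G) - sg G]. *)
Lemma sg_le_mul (T U : finType) (e : rel T) (f : rel U) :
  connected_graph f -> 0 < #|U| -> sg e <= sg f * #|T|.
Proof.
move=> con_f U_gt0; apply: leq_trans (sg_le_card e) _.
by rewrite leq_pmull // sg_gt0.
Qed.

Lemma cartesian_product_connected (T U : finType) (e : rel T) (f : rel U) :
  connected_graph e -> connected_graph f ->
  connected_graph (cartesian_product e f).
Proof.
move=> [sym_e irr_e con_e] [sym_f irr_f con_f].
split=> [a b|a|[x y] [x' y']]; rewrite /cartesian_product.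
- by rewrite eq_sym sym_f [a.2 == _]eq_sym sym_e.
- by rewrite irr_e irr_f !andbF.
apply: (@connect_trans _ _ (x', y)).
  have /connectP[p ep ->] := con_e x x'; elim: p x ep => //= z p IHp x /andP[xz /IHp].
  by apply: connect_trans; apply: connect1; rewrite /= eqxx xz orbT.
have /connectP[p ep ->] := con_f y y'; elim: p y ep => //= z p IHp y /andP[yz /IHp].
by apply: connect_trans; apply: connect1; rewrite /= eqxx yz.
Qed.

(* Main.v *)
Require Import Defs.
From mathcomp Require Import all_boot.
From mathcomp Require Import boolp.

Set Implicit Arguments.
Unset Strict Implicit.
Unset Printing Implicit Defensive.

(** Let [S] be a minimum strong geodetic set of [H], fix [y0] in [S] and a
    vertex [x0] of [G], and put [o = (x0, y0)].  Then [V(G) x (S \ y0)] together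
    with [o] is strong geodetic in the product: inside the fiber over [x] the
    selected paths between vertices of [S \ y0] are kept, and the selected path
    from [y0] to [y] is covered by the geodesic which goes from [o] to [(x, y0)]
    and then inside the fiber to [(x, y)].  This gives the upper bound
    [n(G) (sg H - 1) + 1], and [n(G) >= sg G]. *)

Lemma shortest_path_nil (T : finType) (e : rel T) (x : T) :
  shortest_path e x x [::].
Proof. by split. Qed.

Lemma path_selectionC (T : finType) (e : rel T) (S : {set T}) g (x y : T) :
  path_selection e S g -> x \in S -> y \in S -> x != y ->
  y :: g y x =i x :: g x y.
Proof.
by move=> gP xS yS xy v; have [_ ->] := gP _ _ xS yS xy; rewrite mem_rev.
Qed.

Lemma path_selection_setT_exists (T : finType) (e : rel T) :
  connected_graph e -> 1 < #|T| -> exists g, path_selection e [set: T] g.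
Proof.
move=> con_e T_gt1; case: (strong_geodetic_setT con_e (ltnW T_gt1)).
  by case=> T1; rewrite T1 in T_gt1.
by case=> g gP _; exists g.
Qed.

(** Each step of a walk in the product moves exactly one coordinate, so sorting the steps by the
    coordinate they move splits the walk into one walk per factor. *)
Lemma cartesian_product_walk (T U : finType) (e : rel T) (f : rel U) q
    (a : T * U) :
  path (cartesian_product e f) a q ->
  exists p1 p2, [/\ path e a.1 p1 /\ last a.1 p1 = (last a q).1,
    path f a.2 p2 /\ last a.2 p2 = (last a q).2 & size p1 + size p2 = size q].
Proof.
elim: q a => [|b q IHq] a /=; first by exists [::], [::].
case/andP=> ab /IHq[p1 [p2 [[ep1 lp1] [fp2 lp2] <-]]].
case/orP: ab => /andP[/eqP eqab ab].
  by exists p1, (b.2 :: p2); rewrite /= eqab ab addnS.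
by exists (b.1 :: p1), p2; rewrite /= eqab ab addSn.
Qed.

(** Minimality holds because any competing walk splits into walks of the factors with the same ends,
    which are at least as long as [p1] and [p2]. *)
Lemma shortest_path_product (T U : finType) (e : rel T) (f : rel U)
    (x x' : T) (y y' : U) p1 p2 :
  shortest_path e x x' p1 -> shortest_path f y y' p2 ->
  shortest_path (cartesian_product e f) (x, y) (x', y')
    ([seq (z, y) | z <- p1] ++ [seq (x', z) | z <- p2]).
Proof.
move=> [ep1 lp1 min1] [fp2 lp2 min2].
have lastl : last (x, y) [seq (z, y) | z <- p1] = (x', y).
  by rewrite (last_map (fun z => (z, y))) lp1.
split=> [||q].
- rewrite cat_path lastl; apply/andP; split.
    apply: (homo_path (e := e)) ep1 => u v uv.
    by rewrite /cartesian_product /= eqxx uv orbT.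
  apply: (homo_path (e := f)) fp2 => u v uv.
  by rewrite /cartesian_product /= eqxx uv.
- by rewrite last_cat lastl (last_map (pair x')) lp2.
case/cartesian_product_walk=> q1 [q2 [[eq1 lq1] [fq2 lq2] <-]] lq.
by rewrite size_cat !size_map leq_add ?min1 ?min2 ?lq1 ?lq2 ?lq.
Qed.

Lemma strong_geodetic_iso (T U : finType) (e : rel T) (f : rel U)
    (h : T -> U) (k : U -> T) (S : {set T}) :
  cancel h k -> cancel k h -> (forall x y, f (h x) (h y) = e x y) ->
  strong_geodetic e S -> strong_geodetic f (h @: S).
Proof.
move=> hK kK he [[T1 ->]|[g gP gcov]].
  left; split; first by rewrite -T1; apply/esym/bij_eq_card; exists k; eauto.
  by apply/setP=> u; rewrite inE -[u]kK imset_f.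
have path_h x p : path f (h x) (map h p) = path e x p.
  by rewrite path_map; apply: eq_path.
right; exists (fun u v => map h (g (k u) (k v))) => [u v|u].
  case/imsetP=> x xS -> /imsetP[y yS ->]; rewrite !hK (can_eq hK) => xy.
  have [[ep lp minp] revp] := gP x y xS yS xy; split; last first.
    by rewrite -map_cons revp map_rev.
  split=> [||q]; rewrite ?path_h // ?last_map ?lp // size_map => fq lq.
  (* A competitor [q] is pulled back along [k] to a walk of the same length in the source graph. *)
  rewrite -(size_map k); have qE : map h (map k q) = q by rewrite mapK.
  by apply: minp; rewrite -?path_h ?qE // -[y]hK -lq -[x in LHS]hK last_map.
have [x [y [xS yS xy kuP]]] := gcov (k u); exists (h x), (h y).
by rewrite !imset_f // (can_eq hK) !hK -map_cons -[u]kK map_f.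
Qed.

(** Swapping the coordinates is an isomorphism of the two products; this transfers a bound proved
    for one factor to the other. *)
Lemma sg_cartesian_productC (T U : finType) (e : rel T) (f : rel U) :
  connected_graph e -> connected_graph f -> 0 < #|T| -> 0 < #|U| ->
  sg (cartesian_product e f) <= sg (cartesian_product f e).
Proof.
move=> con_e con_f T_gt0 U_gt0.
have [|_ le_sg] := sgP (cartesian_product_connected con_e con_f).
  by rewrite card_prod muln_gt0 T_gt0.
have [|[S gS <-] _] := sgP (cartesian_product_connected con_f con_e).
  by rewrite card_prod muln_gt0 U_gt0.
pose sw A B (a : A * B) := (a.2, a.1).
have swK A B : cancel (@sw A B) (@sw B A) by case.
rewrite -(card_imset _ (can_inj (swK U T))); apply: le_sg.
apply: strong_geodetic_iso (swK U T) (swK T U) _ gS => a b.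
by rewrite /cartesian_product /= orbC.
Qed.

Lemma sg_cartesian_product_le (T U : finType) (e : rel T) (f : rel U) :
  connected_graph e -> connected_graph f -> 0 < #|T| -> 1 < #|U| ->
  sg (cartesian_product e f) <= #|T| * (sg f).-1 + 1.
Proof.
move=> con_e con_f T_gt0 U_gt1; have U_gt0 := ltnW U_gt1.
have con_ef := cartesian_product_connected con_e con_f.
have TU_gt1 : 1 < #|{: T * U}|.
  by rewrite card_prod; apply: leq_trans U_gt1 _; rewrite leq_pmull.
have [_ le_sg] := sgP con_ef (ltnW TU_gt1).
have [[S gS cardS] _] := sgP con_f U_gt0.
have /card_gt0P[y0 y0S] : 0 < #|S| by rewrite cardS sg_gt0.
have /card_gt0P[x0 _] := T_gt0.
case: gS => [[U1]|[g gP gcov]]; first by rewrite U1 in U_gt1.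
(* A selection must serve every pair; [k] supplies arbitrary geodesics for the pairs that the
   covering argument never uses. *)
have [k kP] := path_selection_setT_exists con_ef TU_gt1.
have /choice[h hP] x : exists p, shortest_path e x0 x p.
  by apply: shortest_path_exists; case: con_e.
pose o := (x0, y0).
pose P := o |: setX setT (S :\ y0).
have inP a : (a \in P) = (a == o) || (a.2 != y0) && (a.2 \in S).
  by rewrite !inE.
have P_S a : a \in P -> a.2 \in S.
  by rewrite inP => /orP[/eqP->|/andP[]].
have P_y0 a : a \in P -> a != o -> a.2 != y0.
  by rewrite inP => /orP[->|/andP[]].
(* The summand [1] counts [o], which lies outside the product set since [y0] was removed from
   [S]. *)
have <- : #|P| = #|T| * (sg f).-1 + 1.
  rewrite cardsU1 cardsX cardsT -cardS (cardsD1 y0 S) y0S /= addnC.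
  by rewrite !inE eqxx.
apply: le_sg; right.
(* [r a] runs from [o] along the row of [y0] to [(a.1, y0)], then up the fiber over [a.1] along the
   path selected in [S]. *)
pose r a := [seq (z, y0) | z <- h a.1] ++ [seq (a.1, z) | z <- g y0 a.2].
have rP a : a \in P -> a != o -> shortest_path (cartesian_product e f) o a (r a).
  move=> aP ao; rewrite [a in shortest_path _ _ a]surjective_pairing.
  apply: shortest_path_product; first exact: hP.
  by have [] := gP y0 a.2 y0S (P_S a aP); rewrite 1?eq_sym ?P_y0.
(* The second branch reads [r a] backwards, so that both orders of a pair containing [o] give the
   same path. *)
pose s a b := if a == o then r b else
  if b == o then rev (belast o (r a)) else
  if a.1 == b.1 then [seq (a.1, z) | z <- g a.2 b.2] else k a b.
exists s => [a b aP bP ab|[x y]].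
  have revr c : c \in P -> c != o -> c :: rev (belast o (r c)) = rev (o :: r c).
    by move=> cP co; have [_ lc _] := rP c cP co; rewrite [o :: _]lastI rev_rcons lc.
  rewrite /s; case: (eqVneq a o) => [ao|ao].
    have bo : b != o by rewrite -ao eq_sym.
    by rewrite ao (negPf bo); split; [exact: rP | exact: revr].
  case: (eqVneq b o) => [->|bo].
    split; first by apply: shortest_path_rev (rP _ aP ao); case: con_ef.
    by rewrite revr // revK.
  rewrite [b.1 == a.1]eq_sym; case: (eqVneq a.1 b.1) => [ab1|_]; last first.
    by apply: kP; rewrite ?inE.
  have ab2 : a.2 != b.2.
    by apply: contraNneq ab => ab2; apply/eqP/injective_projections.
  have [sp revp] := gP _ _ (P_S a aP) (P_S b bP) ab2.
  have abE : (a.1, b.2) = b by rewrite ab1 -surjective_pairing.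
  split.
    have := shortest_path_product (shortest_path_nil e a.1) sp.
    by rewrite abE -surjective_pairing.
  rewrite [b in b :: _]surjective_pairing [a in rev (a :: _)]surjective_pairing.
  by rewrite -ab1 -!(map_cons (pair a.1)) revp map_rev.
have fiberP z : z \in S -> z != y0 -> (x, z) \in P.
  by move=> zS zy0; rewrite inP /= zy0 zS orbT.
have fiber_o z : z != y0 -> (x, z) != o.
  by apply: contraNneq => -[_ ->].
(* The fiber over [x] has no vertex of [P] at height [y0] unless [x = x0], so the pair [y0], [z] is
   replaced by [o], [(x, z)]. *)
have from_y0 z : z \in S -> z != y0 -> y \in y0 :: g y0 z ->
    exists a b, [/\ a \in P, b \in P, a != b & (x, y) \in a :: s a b].
  move=> zS zy0 yz; exists o, (x, z); split.
  - exact: setU11.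
  - exact: fiberP.
  - by rewrite eq_sym fiber_o.
  rewrite /s eqxx /r /= -cat_cons mem_cat.
  (* For [y = y0], the vertex [(x, y0)] is the corner where [r] turns into the fiber; it is [o]
     itself when [x = x0]. *)
  case/predU1P: yz => [->|yz]; last by rewrite (map_f (pair x)) ?orbT.
  have [_ lx _] := hP x.
  by rewrite -(map_cons (fun z => (z, y0))) map_f // -[x in x \in _]lx mem_last.
have [u [v [uS vS uv yuv]]] := gcov y.
have [uy0|uy0] := eqVneq u y0.
  by apply: (from_y0 v); rewrite -?uy0 // eq_sym.
have [vy0|vy0] := eqVneq v y0.
  by apply: (from_y0 u); rewrite -?vy0 // (path_selectionC gP).
exists (x, u), (x, v); split; rewrite ?fiberP //.
  by apply: contraNneq uv => -[->].
by rewrite /s !(negPf (fiber_o _ _)) // eqxx -(map_cons (pair x)) map_f.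
Qed.

Theorem theorem2p1 (T U : finType) (G : rel T) (H : rel U)
    (hG : connected_graph G) (hH : connected_graph H)
    (nG : 1 < #|T|) (nH : 1 < #|U|) :
  sg (cartesian_product G H) <=
    minn (sg H * #|T| - sg G + 1) (sg G * #|U| - sg H + 1).
Proof.
(* The left product is [sg f * #|A| - #|A|], and [sg e] is at most [#|A|]. *)
have bound (A B : finType) (e : rel A) (f : rel B) :
    #|A| * (sg f).-1 + 1 <= sg f * #|A| - sg e + 1.
  by rewrite leq_add2r -subn1 mulnBr muln1 mulnC leq_sub2l ?sg_le_card.
have [T_gt0 U_gt0] := (ltnW nG, ltnW nH).
rewrite leq_min; apply/andP; split; apply: leq_trans (bound _ _ _ _).
  exact: sg_cartesian_product_le.
apply: leq_trans (sg_cartesian_productC hG hH T_gt0 U_gt0) _.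
exact: sg_cartesian_product_le.
Qed.
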